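(* Let $(X,c_u)$ be a connected digital image, where $X\subset\mathbb{Z}^n$ and $1\le u\le n$. Let $x_0=(x_1,\ldots,x_n)\in X$, where each $x_i\in\mathbb{Z}$. Suppose that, for some index $i$, $x_0$ is a 1-coordinate local extremum (at index $i$) for $(X,c_u)$ with a justifying neighbor $x'\in X$ at index $i$. Let $A$ be a freezing set for $(X,c_u)$. Then $x_0\in A$.
   Context: For $X\subset\mathbb{Z}^n$ and $1\le u\le n$, points $x=(x_1,\ldots,x_n)$ and $y=(y_1,\ldots,y_n)$ of $X$ are $c_u$-adjacent, written $x\leftrightarrow_{c_u}y$, if $x\ne y$, for at most $u$ indices $i$ we have $|x_i-y_i|=1$, and for all indices $j$ with $|x_j-y_j|\neq 1$ we have $x_j=y_j$. The digital image $(X,c_u)$ is the graph with vertex set $X$ and adjacency $c_u$. It is connected if for all $a,b\in X$ there is a finite sequence $\{y_i\}_{i=0}^m$ in $X$ with $y_0=a$, $y_m=b$, and, for $0\le i<m$, $y_i=y_{i+1}$ or $y_i\leftrightarrow_{c_u} y_{i+1}$. Let $N(X,x,c_u)=\{y\in X\mid x\leftrightarrow_{c_u}y\}$. A point $x=(x_1,\ldots,x_n)\in X$ is a 1-coordinate local maximum at index $i$ for $(X,c_u)$ if $x_i>y_i$ for all $y=(y_1,\ldots,y_n)\in N(X,x,c_u)$; in this case $x'=(x_1,\ldots,x_{i-1},x_i-1,x_{i+1},\ldots,x_n)$ is the justifying neighbor of $x$ at index $i$. It is a 1-coordinate local minimum at index $i$ if $x_i<y_i$ for all $y=(y_1,\ldots,y_n)\in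 N(X,x,c_u)$; in this case $x'=(x_1,\ldots,x_{i-1},x_i+1,x_{i+1},\ldots,x_n)$ is the justifying neighbor of $x$ at index $i$. The point $x'$ need not belong to $X$ in general. A 1-coordinate local extremum is a point that is a 1-coordinate local maximum or a 1-coordinate local minimum. A function $f:X\to X$ is $c_u$-continuous if $x\leftrightarrow_{c_u}x'$ implies $f(x)=f(x')$ or $f(x)\leftrightarrow_{c_u}f(x')$. $C(X,c_u)$ is the set of $c_u$-continuous functions $X\to X$, and $\mathrm{Fix}(f)=\{x\in X\mid f(x)=x\}$. A set $A\subset X$ is a freezing set for $(X,c_u)$ if for every $g\in C(X,c_u)$, $A\subset\mathrm{Fix}(g)$ implies $g=\mathrm{id}_X$. *)

(* Defs.v *)
From mathcomp Require Import all_boot all_order all_algebra.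
From mathcomp Require Import boolp classical_sets.

Set Implicit Arguments.
Unset Strict Implicit.
Unset Printing Implicit Defensive.

Import Order.TTheory GRing.Theory Num.Theory.
Local Open Scope classical_set_scope.
Local Open Scope ring_scope.

(* Points of Z^n are row vectors of type 'rV[int]_n; x 0 i is coordinate i. *)

Definition adj (n u : nat) (x y : 'rV[int]_n) : Prop :=
  [/\ x <> y,
      (#|[pred i : 'I_n | absz (x 0 i - y 0 i)%R == 1]| <= u)%N
    & forall j : 'I_n, absz (x 0 j - y 0 j)%R <> 1%N -> x 0 j = y 0 j].

Definition digitally_connected (n u : nat) (X : set 'rV[int]_n) : Prop :=
  forall a b : 'rV[int]_n, X a -> X b ->
  exists (m : nat) (y : nat -> 'rV[int]_n),
    [/\ forall k : nat, (k <= m)%N -> X (y k),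
        y 0%N = a, y m = b
      & forall k : nat, (k < m)%N -> y k = y k.+1 \/ adj u (y k) (y k.+1)].

Definition neighbors (n u : nat) (X : set 'rV[int]_n) (x : 'rV[int]_n) :
    set 'rV[int]_n :=
  [set y | X y /\ adj u x y].

Definition local_max (n u : nat) (X : set 'rV[int]_n) (i : 'I_n)
    (x : 'rV[int]_n) : Prop :=
  X x /\ forall y, neighbors u X x y -> y 0 i < x 0 i.

Definition local_min (n u : nat) (X : set 'rV[int]_n) (i : 'I_n)
    (x : 'rV[int]_n) : Prop :=
  X x /\ forall y, neighbors u X x y -> x 0 i < y 0 i.

(* An isolated point is both a maximum and a minimum at i, and then has two
   justifying neighbors, neither of them in X when 1 <= u. *)
Definition justifying_neighbor (n u : nat) (X : set 'rV[int]_n) (i : 'I_n)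
    (x x' : 'rV[int]_n) : Prop :=
  (local_max u X i x /\ x' = x - delta_mx 0 i) \/
  (local_min u X i x /\ x' = x + delta_mx 0 i).

Definition local_extremum (n u : nat) (X : set 'rV[int]_n) (i : 'I_n)
    (x : 'rV[int]_n) : Prop :=
  local_max u X i x \/ local_min u X i x.

Definition continuous_maps (n u : nat) (X : set 'rV[int]_n) : set (X -> X) :=
  [set f | forall x y : X, adj u (val x) (val y) ->
             f x = f y \/ adj u (val (f x)) (val (f y))].

Definition Fix (n : nat) (X : set 'rV[int]_n) (f : X -> X) :
    set 'rV[int]_n :=
  [set val x | x in [set x : X | f x = x]].

Definition freezing_set (n u : nat) (X A : set 'rV[int]_n) : Prop :=
  A `<=` X /\
  forall g : X -> X, continuous_maps u g -> A `<=` Fix g -> g = id.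

(* Main.v *)
(* The map sending x0 to x' and fixing every other point is continuous: a
   neighbor of x0 in X differs from x0 by exactly one unit at index i, in the
   direction of x', so it is equal or adjacent to x'. This map is not the
   identity, so a freezing set cannot avoid its only moved point x0. *)

Require Import Defs.
From mathcomp Require Import all_boot all_order all_algebra.
From mathcomp Require Import boolp classical_sets.
From mathcomp Require Import zify.

Set Implicit Arguments.
Unset Strict Implicit.
Unset Printing Implicit Defensive.

Import Order.TTheory GRing.Theory Num.Theory.
Local Open Scope classical_set_scope.
Local Open Scope ring_scope.

Lemma adj_sym (n u : nat) (x y : 'rV[int]_n) : adj u x y -> adj u y x.
Proof.
case=> neq_xy le_u coord_eq; split; first by move=> eq_yx; apply: neq_xy.
- rewrite (eq_card (B := [pred i : 'I_n | absz (x 0 i - y 0 i)%R == 1%N])) //.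
  by move=> j; rewrite !inE distnC.
- by move=> j; rewrite distnC => /coord_eq.
Qed.

(** Passing from [x] to [x'] makes the difference with [y] vanish at [i] and leaves every other
    difference unchanged, so the number of unit differences cannot grow. It may drop to zero, which
    is the case [x' = y]. *)
Lemma adj_absorb (n u : nat) (i : 'I_n) (x x' y : 'rV[int]_n) :
    adj u x y -> x' 0 i = y 0 i -> (forall j, j != i -> x' 0 j = x 0 j) ->
  x' = y \/ adj u x' y.
Proof.
move=> [_ le_u coord_eq] x'i x'j.
have [|/eqP neq_x'y] := eqVneq x' y; [by left | right; split=> //].
- apply: leq_trans le_u; apply/subset_leq_card/fintype.subsetP => j; rewrite !inE.
  by have [->|/x'j ->] := eqVneq j i; first by rewrite x'i subrr.
- by move=> j; have [->|/x'j ->] := eqVneq j i => // /coord_eq.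
Qed.

Lemma adj_coord_dist (n u : nat) (x y : 'rV[int]_n) (i : 'I_n) :
  adj u x y -> x 0 i <> y 0 i -> absz (x 0 i - y 0 i)%R = 1%N.
Proof.
case=> _ _ coord_eq neq_i.
by have [//|/eqP /coord_eq] := eqVneq (absz (x 0 i - y 0 i)%R) 1%N.
Qed.

(** Adjacency limits the distance at [i] to 0 or 1; strict extremality excludes 0 and fixes the
    sign. *)
Lemma justifying_neighbor_coord (n u : nat) (X : set 'rV[int]_n) (i : 'I_n)
    (x x' y : 'rV[int]_n) :
  justifying_neighbor u X i x x' -> neighbors u X x y -> x' 0 i = y 0 i.
Proof.
move=> jx Nxy; have dist1 := adj_coord_dist (i := i) Nxy.2.
case: jx => -[[_ ext] ->]; have lt_i := ext y Nxy.
- have /dist1 : x 0 i <> y 0 i by lia.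
  by rewrite !mxE !eqxx /=; lia.
- have /dist1 : x 0 i <> y 0 i by lia.
  by rewrite !mxE !eqxx /=; lia.
Qed.

Lemma justifying_neighbor_offcoord (n u : nat) (X : set 'rV[int]_n)
    (i j : 'I_n) (x x' : 'rV[int]_n) :
  justifying_neighbor u X i x x' -> j != i -> x' 0 j = x 0 j.
Proof.
by case=> -[_ ->] /negPf neq_ji; rewrite !mxE neq_ji andbF ?subr0 ?addr0.
Qed.

Lemma justifying_neighbor_neq (n u : nat) (X : set 'rV[int]_n) (i : 'I_n)
    (x x' : 'rV[int]_n) : justifying_neighbor u X i x x' -> x' <> x.
Proof.
by case=> -[_ ->] /rowP /(_ i); rewrite !mxE !eqxx /=; lia.
Qed.

(** This part is purely graph-theoretic: the geometry of extrema enters only through [absorb], which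
    makes the map sending [x] to [x'] preserve adjacency up to equality. *)
Lemma freezing_set_mem (n u : nat) (X A : set 'rV[int]_n) (x x' : 'rV[int]_n) :
    X x -> X x' -> x' <> x ->
    (forall y, neighbors u X x y -> x' = y \/ adj u x' y) ->
  freezing_set u X A -> A x.
Proof.
move=> Xx Xx' neq_x'x absorb [sAX freeze]; apply: contrapT => nAx.
pose sx : X := exist _ x (mem_set Xx); pose sx' : X := exist _ x' (mem_set Xx').
(* The test compares underlying vectors, so it does not depend on the membership proof carried by
   [z]. *)
pose g (z : X) : X := if val z == x then sx' else z.
have fixg z : val z <> x -> g z = z by rewrite /g; case: eqP.
have gE z : val z = x -> g z = sx' by rewrite /g => ->; rewrite eqxx.
(* Continuity when only the first endpoint moves; the mirrored case follows by [adj_sym]. *)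
have absorb_g (a b : X) : val a = x -> val b <> x -> adj u (val a) (val b) ->
    g a = g b \/ adj u (val (g a)) (val (g b)).
  move=> ax bx ab; rewrite (gE a ax) (fixg b bx).
  have: neighbors u X x (val b).
    by split; [exact: set_mem (valP b) | rewrite -ax].
  by case/absorb=> [eqb|adjb]; [left; apply: val_inj | right].
have contg : continuous_maps u g.
  move=> a b ab.
  have [ax|/eqP ax] := eqVneq (val a) x; have [bx|/eqP bx] := eqVneq (val b) x.
  - by left; rewrite !gE.
  - exact: absorb_g.
  - by case: (absorb_g b a bx ax (adj_sym ab)) => [->|/adj_sym]; [left | right].
  - by right; rewrite !fixg.
have sAFix : A `<=` Fix g.
  move=> a Aa; exists (exist _ a (mem_set (sAX a Aa))) => //=.
  by apply: fixg => /= ax; apply: nAx; rewrite -ax.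
(* Freezing makes [g] the identity; evaluating at [sx] gives [x' = x]. *)
apply: neq_x'x; have /(congr1 (fun h => val (h sx))) := freeze g contg sAFix.
by rewrite gE.
Qed.

Theorem theorem6p2 (n u : nat) (X : set 'rV[int]_n)
    (hu1 : (1 <= u)%N) (hun : (u <= n)%N)
    (hX : digitally_connected u X)
    (x0 : 'rV[int]_n) (hx0 : X x0) (i : 'I_n)
    (hext : local_extremum u X i x0)
    (x' : 'rV[int]_n) (hx' : justifying_neighbor u X i x0 x') (hx'X : X x')
    (A : set 'rV[int]_n) (hA : freezing_set u X A) :
  A x0.
Proof.
apply: freezing_set_mem hx0 hx'X (justifying_neighbor_neq hx') _ hA => y x0y.
apply: (adj_absorb x0y.2) (justifying_neighbor_coord hx' x0y) _ => j.
exact: justifying_neighbor_offcoord hx'.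
Qed.
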